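(* Let $r$ be a real number with $r > 0$. Then for all complex numbers $A, B \in \mathbb{C}$: $A \leq B$ if and only if $rA \leq rB$.
   Context: The relation $\leq$ on $\mathbb{C}$ is defined as follows. Write $A = a_1 + a_2 i$, $B = b_1 + b_2 i$ with $a_1,a_2,b_1,b_2 \in \mathbb{R}$. Then $A \leq B$ means: $a_1 < b_1$, or ($a_1 = b_1$ and $a_2 \leq b_2$). *)

(* Defs.v *)
From Stdlib Require Import Reals.
From Coquelicot Require Import Coquelicot.
Open Scope R_scope.

Definition Cle (A B : C) : Prop :=
  Re A < Re B \/ (Re A = Re B /\ Im A <= Im B).

(* Main.v *)
Require Import Defs.
From Stdlib Require Import Reals Lra.
From Coquelicot Require Import Coquelicot.
Open Scope R_scope.

Lemma Re_RtoC_mult (r : R) (z : C) : Re (RtoC r * z)%C = r * Re z.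
Proof. unfold Re; simpl; ring. Qed.

Lemma Im_RtoC_mult (r : R) (z : C) : Im (RtoC r * z)%C = r * Im z.
Proof. unfold Im; simpl; ring. Qed.

(** A real scalar acts on the real and imaginary parts separately, and scaling
    by [r > 0] is an order automorphism of the real line, so it preserves and
    reflects each of [<], [=] and [<=] out of which the lexicographic order is
    built. *)
Theorem theorem4 (r : R) (hr : r > 0) :
  forall A B : C, Cle A B <-> Cle (RtoC r * A)%C (RtoC r * B)%C.
Proof.
  intros A B; unfold Cle.
  rewrite !Re_RtoC_mult, !Im_RtoC_mult.
  split; (intros [H | [H1 H2]]; [left | right; split]).
  - now apply Rmult_lt_compat_l.
  - now rewrite H1.
  - apply Rmult_le_compat_l; lra.
  - now apply Rmult_lt_reg_l with r.
  - apply Rmult_eq_reg_l with r; lra.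
  - now apply Rmult_le_reg_l with r.
Qed.
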